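(* Let $X$ be a compact metric space with its Borel $\sigma$-algebra, and let $(X_n)_{n\in\mathbb{N}}$ be a time-homogeneous Markov chain with state space $X$ and transition operator $\pi$, where $\pi u(x)=E_x(u(X_1))$. Suppose that for every bounded continuous function $u:X\to\mathbb{R}$ the map $x\mapsto\pi u(x)$ is continuous on $X$. Let $\mathcal{U}_1$ be the collection of the continuous (strictly) positive functions $u:X\to\mathbb{R}$, and define $$\forall\mu\in\mathcal{M}(X)\qquad I(\mu)\,=\,-\inf_{u\in\mathcal{U}_1}\,\int_X\ln\Big(\frac{\pi u}{u}\Big)(x)\,\mu(dx)\,.$$ Then for any closed convex subset $C$ of $\mathcal{M}(X)$, $$\forall n\geq 1\qquad \inf_{x\in X}\,P_x\Big(\frac1n L_n\in C\Big)\,\leq\,\exp\Big(-n\,\inf_{\mu\in C}\,I(\mu)\Big)\,.$$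
   Context: $P_x$ and $E_x$ denote probability and expectation for the Markov chain $(X_n)_{n\in\mathbb{N}}$ started at $X_0=x$. Local time: for $n\ge 1$ and $A\subset X$ Borel, $L_n(A)=\sum_{k=0}^{n-1}1_{\{X_k\in A\}}$; thus $\frac1n L_n$ is a random Borel probability measure on $X$. $\mathcal{M}(X)$ is the set of Borel probability measures on $X$, endowed with the topology of weak convergence. The function $I$ takes values in $[0,+\infty]$. Conventions: $\inf\emptyset=+\infty$ and $\exp(-\infty)=0$. *)

(* Defs.v *)
From HB Require Import structures.
From mathcomp Require Import all_boot all_order all_algebra.
From mathcomp Require Import all_classical all_reals all_analysis.

Set Implicit Arguments.
Unset Strict Implicit.
Unset Printing Implicit Defensive.

Import Order.TTheory GRing.Theory Num.Theory.
Import numFieldNormedType.Exports.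

Local Open Scope classical_set_scope.
Local Open Scope ring_scope.

(* Measurable types are pointed in the library, so a metric space carrying a
   Borel sigma-algebra has to be nonempty. *)
#[short(type="pointedMetricType")]
HB.structure Definition PointedMetric (R : numDomainType) :=
  {T of Metric R T & Pointed T}.

Notation borel X := (g_sigma_algebraType (@open X)).

Section probability_constructions.
Local Open Scope ereal_scope.
Context d (T : measurableType d) (R : realType).

Definition mixture (t : {i01 R}) (mu nu : probability T R) : set T -> \bar R :=
  measure_add (mscale (t%:inum%:nng)%R mu) (mscale ((1 - t%:inum)%:nng)%R nu).

HB.instance Definition _ t mu nu := Measure.on (mixture t mu nu).

Lemma mixture_setT t mu nu : mixture t mu nu [set: T] = 1.
Proof.
rewrite /mixture measure_addE/= /mscale/= !probability_setT !mule1 -EFinD.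
by rewrite addrC subrK.
Qed.

HB.instance Definition _ t mu nu :=
  Measure_isProbability.Build _ _ _ (mixture t mu nu) (mixture_setT t mu nu).

Definition convex_prob (C : set (probability T R)) :=
  forall (t : {i01 R}) mu nu, C mu -> C nu -> C (mixture t mu nu).

Definition local_time (n : nat) (x : nat -> T) : {measure set T -> \bar R} :=
  msum (fun k => \d_(x k)) n.

Definition empirical n of (0 < n)%N := fun (x : nat -> T) =>
  mscale ((n%:R^-1)%:nng)%R (local_time n x) : set T -> \bar R.

HB.instance Definition _ n (n0 : (0 < n)%N) x := Measure.on (empirical n0 x).

Lemma empirical_setT n (n0 : (0 < n)%N) x : empirical n0 x [set: T] = 1.
Proof.
rewrite /empirical /mscale/= /msum (eq_bigr (fun=> 1)) => [|k _].
  rewrite sumEFin big_const_ord iter_addr addr0 -EFinM mulVf//.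
  by rewrite pnatr_eq0 -lt0n.
exact: diracT.
Qed.

HB.instance Definition _ n (n0 : (0 < n)%N) x :=
  Measure_isProbability.Build _ _ _ (empirical n0 x) (empirical_setT n0 x).

End probability_constructions.
Arguments empirical {d T R n}.

Section weak_topology.
Context (R : realType) (X : pointedMetricType R).

Definition bounded_continuous : set (X -> R) :=
  [set f | continuous f /\ bounded_fun f].

Definition pairing (mu : probability (borel X) R) :
    {ptws bounded_continuous -> R} :=
  fun f => \int[mu]_x (\val f : X -> R) x.

(* The topology of weak convergence: the coarsest one that makes
   mu |-> \int f dmu continuous for all bounded continuous f. Two terms of type
   probability may differ on non-measurable sets only; they have the same
   pairings, so that a closed set contains both or neither. *)
Definition weak_prob : topologicalType := initial_topology pairing.

End weak_topology.

Section markov_chain.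
Local Open Scope ereal_scope.
Context d (X : measurableType d) d' (Omega : measurableType d') (R : realType).

(* (Y_n) is a time-homogeneous Markov chain with transition kernel K, and P x is
   the law under which it starts at x. The last clause says that, P x-almost
   surely, P x (Y_(n+1) \in B | Y_0, ..., Y_n) = K (Y_n) B. *)
Definition markov_chain (K : R.-pker X ~> X) (P : X -> probability Omega R)
    (Y : nat -> Omega -> X) :=
  [/\ forall n, measurable_fun [set: Omega] (Y n),
      forall x, {ae P x, forall w, Y 0%N w = x} &
      forall x n A B,
        g_sigma_preimage (fun k : 'I_n.+1 => Y k) A -> measurable B ->
        P x (A `&` Y n.+1 @^-1` B) = \int[P x]_(w in A) K (Y n w) B].

Definition transition_op (P : X -> probability Omega R)
    (Y : nat -> Omega -> X) (u : X -> R) (x : X) : R :=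
  fine 'E_(P x)[u \o Y 1%N].

End markov_chain.

Definition rate (R : realType) (X : pointedMetricType R)
    (pi : (X -> R) -> X -> R) (mu : probability (borel X) R) : \bar R :=
  (- ereal_inf [set \int[mu]_x (ln (pi u x / u x))%:E |
                u in [set u : X -> R | continuous u /\ forall x, (0 < u x)%R]])%E.

(* Main.v *)
Require Import Defs.
From HB Require Import structures.
From mathcomp Require Import all_boot all_order all_algebra.
From mathcomp Require Import all_classical all_reals all_analysis.
From mathcomp Require Import measurable_realfun.
From mathcomp Require Import zify ring lra.

Set Implicit Arguments.
Unset Strict Implicit.
Unset Printing Implicit Defensive.

Import Order.TTheory GRing.Theory Num.Theory.
Import numFieldNormedType.Exports.

Local Open Scope classical_set_scope.
Local Open Scope ring_scope.

(** The proof is a change of measure followed by a minimax argument. If u is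
    continuous and positive, the product of the ratios u(Y_(k+1)) / pi u(Y_k),
    k < n, has expectation 1 under every P x. Started at a minimum point of u,
    it is at least exp (- n * \int ln (pi u / u) d(L_n / n)), so that the
    infimum over x of P x (L_n / n \in C) is at most
    exp (n * sup_(nu in C) \int ln (pi u / u) dnu). It remains to exchange the
    infimum over u with the supremum over nu: the functional is affine in nu
    and convex in ln u, and C is compact.

    Compactness of the space of probability measures for the weak topology is
    obtained from ultrafilters: the setwise ultralimit m of probability
    measures is finitely additive; the Borel measure it generates through
    covers by open sets dominates m on closed sets, and by the layer cake
    formula this makes it the weak limit. *)

(** * Finitely additive set functions and Borel measures *)

Section borel_sets.
Context (R : realType) (X : pointedMetricType R).

Lemma open_borel (A : set X) : open A -> measurable (A : set (borel X)).
Proof. exact: sub_sigma_algebra. Qed.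

Lemma closed_borel (A : set X) : closed A -> measurable (A : set (borel X)).
Proof.
move=> cA; rewrite -[A]setCK; apply: measurableC; apply: open_borel.
exact: closed_openC.
Qed.

End borel_sets.

Section borel_regularization.
Context (R : realType) (X : pointedMetricType R).
Variable m : set (borel X) -> R.
Hypotheses (X_compact : compact [set: X]) (m_ge0 : forall A, 0 <= m A)
  (mT : m [set: X] = 1).
Hypothesis mU : forall A B, measurable A -> measurable B ->
  A `&` B = set0 -> m (A `|` B) = m A + m B.

Let m0 : m set0 = 0.
Proof.
have := mU measurable0 measurable0 (setI0 _); rewrite setU0 => /eqP.
by rewrite -subr_eq subrr eq_sym => /eqP.
Qed.

Let mD A B : measurable A -> measurable B -> A `<=` B ->
  m (B `\` A) = m B - m A.
Proof.
move=> mA mB AB; rewrite -[in RHS](setDUK AB) mU ?setDIK//.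
  by rewrite addrAC subrr add0r.
exact: measurableD.
Qed.

Let le_m A B : measurable A -> measurable B -> A `<=` B -> m A <= m B.
Proof. by move=> mA mB AB; rewrite -subr_ge0 -mD. Qed.

Let m_le1 A : measurable A -> m A <= 1.
Proof. by move=> mA; rewrite -mT; exact: le_m. Qed.

Let m_subadd A B : measurable A -> measurable B -> m (A `|` B) <= m A + m B.
Proof.
move=> mA mB; rewrite -[A `|` B](@setDUK _ A)//.
rewrite mU ?setDIK//; last by apply: measurableD => //; exact: measurableU.
rewrite lerD2l; apply: le_m => //.
  by apply: measurableD => //; exact: measurableU.
by move=> x [[]].
Qed.

Let m_subaddn (U : nat -> set (borel X)) n : (forall i, measurable (U i)) ->
  m (\big[setU/set0]_(i < n) U i) <= \sum_(i < n) m (U i).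
Proof.
move=> mU_; elim: n => [|n ih]; first by rewrite !big_ord0 m0.
rewrite !big_ord_recr/= (le_trans (m_subadd _ _))//.
  exact: bigsetU_measurable.
by rewrite lerD2r.
Qed.

(* The value +oo on the other sets restricts the infimum over measurable covers
   in mu_ext to the open ones. *)
Definition open_content (A : set (borel X)) : \bar R :=
  if `[< open (A : set X) >] then (m A)%:E else +oo%E.

Definition regularization : set (borel X) -> \bar R := mu_ext open_content.

Let open_contentE (A : set X) : open A -> open_content A = (m A)%:E.
Proof. by move=> oA; rewrite /open_content asboolT. Qed.

Let open_content_ge0 A : (0 <= open_content A)%E.
Proof. by rewrite /open_content; case: ifPn; rewrite ?lee_fin. Qed.

Let open_content0 : open_content set0 = 0%E.
Proof. by rewrite open_contentE ?m0//; exact: open0. Qed.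

HB.instance Definition _ := isOuterMeasure.Build R (borel X) regularization
  (mu_ext0 open_content0 open_content_ge0) (mu_ext_ge0 open_content_ge0)
  (le_mu_ext open_content)
  (mu_ext_sigma_subadditive open_content_ge0).

Let regularization_le (A : set X) (U : nat -> set X) (c : R) :
  (forall i, open (U i)) -> A `<=` \bigcup_i U i ->
  (forall n, \sum_(0 <= i < n) m (U i) <= c) -> (regularization A <= c%:E)%E.
Proof.
move=> oU AU Uc; apply: (@le_trans _ _ (\sum_(k <oo) open_content (U k))%E).
  apply: ereal_inf_lbound => /=; exists U => //; split => // i.
  exact: open_borel.
apply: lime_le; first by apply: is_cvg_nneseries => *; exact: open_content_ge0.
apply: nearW => n; rewrite (eq_bigr (fun i => (m (U i))%:E)).
  by rewrite sumEFin lee_fin.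
by move=> i _; rewrite open_contentE.
Qed.

Let regularization_open (U : set X) : open U ->
  (regularization U <= (m U)%:E)%E.
Proof.
move=> oU.
apply: (@regularization_le _ (fun i => if i is 0 then U else set0)).
- by case => [//|_]; exact: open0.
- by move=> x Ux; exists 0%N.
- case=> [|n]; first by rewrite big_geq.
  by rewrite big_nat_recl//= big1 ?addr0// => i _; rewrite m0.
Qed.

(** By compactness a countable open cover of [F] has a finite subcover, and on finitely many sets
    the subadditivity of [m] is enough. *)
Let regularization_closed (F : set X) : closed F ->
  ((m F)%:E <= regularization F)%E.
Proof.
move=> cF; apply: le_ereal_inf_tmp => _ [U [mU_ FU] <-].
have [[i ioo]|] := pselect (exists i, open_content (U i) = +oo%E).
  rewrite (eseries_pinfty _ _ ioo) ?leey// => *.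
  by rewrite gt_eqF// (lt_le_trans _ (open_content_ge0 _))// ltNy0.
move/forallNP => oU.
have {}oU i : open (U i : set X).
  apply: contrapT => /asboolPn oUi; apply: (oU i).
  by rewrite /open_content (negbTE oUi).
have : compact F by apply: subclosed_compact X_compact _.
rewrite compact_cover => /(_ nat setT (U : nat -> set X)).
move=> /(_ (fun i _ => oU i) FU) [D' _ FD'].
pose N := (\max_(i <- finmap.enum_fset D') i).+1.
apply: (@le_trans _ _ (\sum_(0 <= i < N) open_content (U i))%E); last first.
  exact: nneseries_lim_ge.
rewrite (eq_bigr (fun i => (m (U i))%:E)) => [|i _]; last exact: open_contentE.
rewrite sumEFin lee_fin big_mkord (le_trans _ (m_subaddn _ _))//.
apply: le_m; [exact: closed_borel| exact: bigsetU_measurable|].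
move=> x /FD'[i iD' Uix]; rewrite -bigcup_mkord; exists i => //=.
by rewrite /N ltnS; exact: (@leq_bigmax_seq _ _ xpredT id).
Qed.

(** A substitute for continuity from below, which [m] may lack. [W] is exhausted by the points at
    distance more than 1/(k+1) from its complement; the rings between successive levels are charged
    by telescoping differences of a bounded sequence, so that those beyond a large rank cost at most
    [e] altogether. *)
Let regularization_inner (W : set X) (e : R) : open W -> 0 < e ->
  exists B B' : set X, [/\ open B, closed B', B `<=` B', B' `<=` W &
    (regularization W <= (m B + e)%:E)%E].
Proof.
move=> oW e0.
pose g (x : X) := edist_inf (~` W) x.
have cg : continuous g by exact: edist_inf_continuous.
pose B k := [set x : X | ((k.+1%:R^-1 : R)%:E < g x)%E].
pose B' k := [set x : X | ((k.+1%:R^-1 : R)%:E <= g x)%E].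
have oB k : open (B k).
  apply: (@open_comp _ _ g [set y | ((k.+1%:R^-1 : R)%:E < y)%E]).
    by move=> x _; exact: cg.
  exact: open_ereal_gt_ereal.
have cB' k : closed (B' k).
  apply: (@preimage_closed _ _ g [set y | ((k.+1%:R^-1 : R)%:E <= y)%E]).
    by move=> x _; exact: cg.
  exact: closed_ereal_le_ereal.
have BB' k : B k `<=` B' k by move=> x /ltW.
have invS k : (k.+2%:R^-1 < k.+1%:R^-1 :> R).
  by rewrite ltf_pV2 ?posrE// ltr_nat.
have B'B k : B' k `<=` B k.+1.
  by move=> x; apply: lt_le_trans; rewrite lte_fin.
have B'W k : B' k `<=` W.
  move=> x; apply: contraPP => nWx; rewrite /B'/= /g edist_inf0//.
  by rewrite lee_fin leNgt invr_gt0 ltr0n.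
have WB x : W x -> exists k, B k x.
  move=> Wx; have /nbhs_ballP[r /= r0 xrW] : nbhs x W by exact: open_nbhs_nbhs.
  have [k _ kr] := near_infty_natSinv_lt (PosNum r0).
  exists k => /=; apply: (@lt_le_trans _ _ r%:E).
    by rewrite lte_fin; exact: (kr k (leqnn k)).
  apply: le_ereal_inf_tmp => _ [y nWy <-]; rewrite leNgt; apply/negP.
  by move/edist_lt_ball => /= /xrW.
pose q k := m (B k).
have qS k : q k <= q k.+1.
  by apply: le_m; [exact: open_borel..|exact: (subset_trans (BB' k) (B'B k))].
have qnd : {homo q : k l / (k <= l)%N >-> k <= l}.
  by apply: homo_leq => //; exact: le_trans.
have qub : has_ubound (range q).
  by exists 1 => _ [k _ <-]; apply: m_le1; apply: open_borel; exact: (oB k).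
pose L := sup (range q).
have qL k : q k <= L by apply: (ub_le_sup qub); exists k.
(* Half of [e] is allotted because each ring spans two levels, so that the increase of [q] beyond
   [N] is counted twice. *)
have [N qN] : exists N, L - e / 2 < q N.
  have e20 : 0 < e / 2 by rewrite divr_gt0.
  have hs : has_sup (range q) by split => //; exists (q 0%N), 0%N.
  by have [_ [N _ <-] ?] := sup_adherent e20 hs; exists N.
(* Removing the closed set [B' k] keeps the ring open; two levels of width make consecutive rings
   overlap and leave no gap. *)
pose Rg k := B k.+2 `\` B' k.
have mRg k : m (Rg k) <= q k.+2 - q k.
  rewrite mD; [|exact: closed_borel|exact: open_borel|].
    by rewrite lerD2l lerN2; apply: le_m;
      [exact: open_borel|exact: closed_borel|].
  by apply: (subset_trans (B'B k)); exact: (subset_trans _ (B'B _)).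
exists (B N.+1), (B' N.+1); split => //.
apply: (@regularization_le _
  (fun i => if i is j.+1 then Rg (N + j)%N else B N.+1)).
- case=> [//|j]; rewrite /Rg setDE; apply: openI => //.
  exact: closed_openC.
- move=> x /WB[k0 Bk0].
  have [k Bk kmin] :=
    ex_minnP (ex_intro (fun k => `[< B k x >]) k0 (asboolT Bk0)).
  have {}Bk := asboolW Bk.
  have [kN|Nk] := leqP k N.+1.
    exists 0%N => //=.
    apply: le_lt_trans Bk; rewrite lee_fin lef_pV2 ?posrE// ler_nat ltnS//.
  (* The cover starts with [B N.+1], so that the ring of number [k - 2] has rank [k - N - 1]. By
     minimality of [k], the point is outside [B k.-1], which contains [B' (k - 2)]. *)
  exists (k - N - 1)%N => //=.
  have -> : (k - N - 1 = (k - N - 2).+1)%N by lia.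
  have -> : (N + (k - N - 2) = k - 2)%N by lia.
  rewrite /Rg; have -> : ((k - 2).+2 = k)%N by lia.
  split => // /B'B; have -> : ((k - 2).+1 = k.-1)%N by lia.
  move=> Bk1; have := kmin _ (asboolT Bk1).
  by lia.
- move=> n.
  (* The differences [q k.+2 - q k] telescope with step two, which leaves two boundary terms at each
     end. *)
  have sumR j : \sum_(0 <= i < j) m (Rg (N + i)%N) <=
      q (N + j).+1 + q (N + j)%N - (q N.+1 + q N).
    elim: j => [|j ih]; first by rewrite big_geq// addn0 subrr.
    rewrite big_nat_recr//= addnS; move: ih (mRg (N + j)%N); lra.
  case: n => [|n]; first by rewrite big_geq// addr_ge0// ltW.
  rewrite big_nat_recl//=; move: (sumR n) (qL (N + n).+1) (qL (N + n)%N) (qS N).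
  move: qN; rewrite -/(q N.+1).
  lra.
Qed.

(** Each open member V of a cover is split by [U]. The part inside [U] is approximated by
    [regularization_inner] with a closed set B', and the part outside lies in the open set of points
    of V outside B'; finite additivity of [m] on V then bounds the two costs together by m(V) up to
    an arbitrary error. *)
Let caratheodory_open (U : set X) : open U -> regularization.-caratheodory U.
Proof.
move=> oU; apply: le_caratheodory_measurable => A.
apply: le_ereal_inf_tmp => _ [V [mV AV] <-].
pose VU i := V i `&` U; pose VC i := V i `&` ~` U.
apply: (@le_trans _ _ (\sum_(i <oo) regularization (VU i) +
    \sum_(i <oo) regularization (VC i))%E).
  apply: leeD.
    apply: le_trans (outer_measure_sigma_subadditive _ VU).
    by apply: le_outer_measure => x [/AV[i _ Vix] Ux]; exists i.
  apply: le_trans (outer_measure_sigma_subadditive _ VC).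
  by apply: le_outer_measure => x [/AV[i _ Vix] Ux]; exists i.
rewrite -nneseriesD; try by move=> *; exact: outer_measure_ge0.
apply: lee_nneseries => [i _ _|i _].
  by rewrite adde_ge0// outer_measure_ge0.
rewrite /open_content; case: ifPn => [/asboolP oV|_]; last exact: leey.
(* The comparison is made term by term, so that the errors need not be summable over the cover. *)
apply/lee_addgt0Pr => e e0.
have [|B [B' [oB cB' BB' B'VU VUe]]] := @regularization_inner (VU i) e _ e0.
  exact: openI.
have oC : open (V i `\` B') by apply: openI => //; exact: closed_openC.
have VCB' : (regularization (VC i) <= (m (V i `\` B'))%:E)%E.
  apply: le_trans (regularization_open oC).
  by apply: le_outer_measure => x [Vx nUx]; split => // /B'VU[].
rewrite (le_trans (leeD VUe VCB'))// -!EFinD lee_fin.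
have B'V : B' `<=` V i by move=> x /B'VU[].
rewrite mD//; last exact: closed_borel.
have : m B <= m B'.
  by apply: le_m; [exact: open_borel|exact: closed_borel|].
lra.
Qed.

Let measurable_caratheodory (A : set (borel X)) : measurable A ->
  regularization.-caratheodory A.
Proof.
apply: smallest_sub; last by move=> U; exact: caratheodory_open.
split; first exact: caratheodory_measurable_set0.
- by move=> B; rewrite setTD; exact: caratheodory_measurable_setC.
- by move=> F; exact: caratheodory_measurable_bigcup.
Qed.

Let regularization_sigma_additive :
  semi_sigma_additive (regularization : set (borel X) -> \bar R).
Proof.
move=> F mF tF mUF; apply: caratheodory_measure_sigma_additive => //.
  by move=> i; exact: measurable_caratheodory.
exact: measurable_caratheodory.
Qed.

HB.instance Definition _ := isMeasure.Build _ (borel X) R regularization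
  (mu_ext0 open_content0 open_content_ge0) (mu_ext_ge0 open_content_ge0)
  regularization_sigma_additive.

Let regularization_setT : regularization [set: borel X] = 1%E.
Proof.
rewrite -mT; apply/eqP; rewrite eq_le regularization_open; last exact: openT.
exact/regularization_closed/closedT.
Qed.

HB.instance Definition _ :=
  Measure_isProbability.Build _ _ _ regularization regularization_setT.

(** A bound on closed sets between measures of the same total mass is the portmanteau criterion,
    which later identifies the weak limit. *)
Lemma exists_borel_regularization : exists mu : probability (borel X) R,
  forall F : set X, closed F -> ((m F)%:E <= mu F)%E.
Proof. by exists regularization => F; exact: regularization_closed. Qed.

End borel_regularization.

(** * Weak convergence of probability measures *)

Lemma Rintegral_cst_probability (R : realType) d (T : measurableType d)
  (mu : probability T R) (r : R) : \int[mu]_x r = r.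
Proof. by rewrite /Rintegral integral_cst//= probability_setT mule1. Qed.

Section continuous_on_compact_metric.
Context (R : realType) (X : pointedMetricType R).
Implicit Type f : X -> R.

Lemma continuous_borel f : continuous f ->
  measurable_fun [set: borel X] (f : borel X -> R).
Proof.
move=> cf; apply: (measurability _ (RGenOInfty.measurableE R)).
move=> /= _ [_ [a ->]] <-; apply: measurableI => //; apply: open_borel.
move/continuousP : cf; apply; exact: rray_open.
Qed.

Hypothesis X_compact : compact [set: X].

Lemma compact_bounded_fun f : continuous f -> bounded_fun f.
Proof.
move=> cf.
have : bounded_set (f @` [set: X]).
  apply: compact_bounded; apply: continuous_compact => //.
  exact: continuous_subspaceT.
by move=> [M [Mr Mf]]; exists M; split => // y /Mf fy x _; apply: fy; exists x.
Qed.

Lemma compact_bound f : continuous f ->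
  exists2 M, 0 < M & forall x, `|f x| <= M.
Proof.
move=> /compact_bounded_fun[M [Mr Mf]]; exists (`|M| + 1).
  by rewrite ltr_wpDl.
by move=> x; apply: (Mf (`|M| + 1)) => //; rewrite ltr_pwDr// ler_norm.
Qed.

Lemma continuous_integrable (mu : probability (borel X) R) f : continuous f ->
  mu.-integrable [set: borel X] (EFin \o f).
Proof.
move=> cf; apply: measurable_bounded_integrable => //.
- by rewrite [ltLHS]probability_setT ltry.
- exact: continuous_borel.
- exact: compact_bounded_fun.
Qed.

Lemma norm_Rintegral_le (mu : probability (borel X) R) f M : continuous f ->
  (forall x, `|f x| <= M) -> `|\int[mu]_x f x| <= M.
Proof.
move=> cf fM; rewrite (le_trans (le_normr_Rintegral _ _))//.
  exact: continuous_integrable.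
have -> : M = \int[mu]_x (cst M) x.
  by rewrite Rintegral_cst_probability.
apply: le_Rintegral => //.
- by apply: (@continuous_integrable mu (fun x => `|f x|)) => x;
    apply: cvg_norm; exact: cf.
- by apply: (@continuous_integrable mu (cst M)); exact: cst_continuous.
Qed.

End continuous_on_compact_metric.

(** * Discrete layer cake formula *)

Section layer_cake.
Context (R : realType).

(** The sum counts the integers from 1 to [N] that are at most [h]. With [le_sum_levels] it locates
    [h] up to one unit. *)
Lemma sum_levels_le (h : R) N : 0 <= h ->
  \sum_(k < N) (k.+1%:R <= h)%R%:R <= h.
Proof.
move=> h0; elim: N => [|N ih]; first by rewrite big_ord0.
rewrite big_ord_recr/=; case: (leP N.+1%:R h) => [Nh|_].
  2: by rewrite mulr0n addr0.
apply: le_trans Nh; rewrite -natr1 lerD//.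
rewrite -[N in leRHS]card_ord -sum1_card natr_sum.
by apply: ler_sum => i _; rewrite lern1 leq_b1.
Qed.

Lemma le_sum_levels (h : R) N : h <= N%:R ->
  h <= 1 + \sum_(k < N) (k.+1%:R <= h)%R%:R.
Proof.
elim: N => [h0|N ih hN]; first by rewrite big_ord0 addr0 (le_trans h0).
have [/ih hN'|Nh] := leP h N%:R.
  by rewrite (le_trans hN')// big_ord_recr/= addrA lerDl.
rewrite (le_trans hN)// -natr1 addrC lerD2l big_ord_recr/= ler_wpDr//.
rewrite (eq_bigr (fun=> 1)); last first.
  move=> i _; rewrite (_ : _ <= _ = true)//; apply/idP.
  apply: le_trans (ltW Nh).
  by rewrite ler_nat.
by rewrite sumr_const card_ord.
Qed.

Context d (T : measurableType d) (mu : probability T R).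

Lemma integrable_sum_indic N (F : nat -> set T) : (forall k, measurable (F k)) ->
  mu.-integrable [set: T] (EFin \o (fun x => \sum_(k < N) (\1_(F k) x : R))).
Proof.
move=> mF; apply: measurable_bounded_integrable => //.
- by rewrite [ltLHS]probability_setT ltry.
- by apply: measurable_sum => k; exact: measurable_indic.
- exists N%:R; split => // M NM x _ /=; apply: le_trans (ltW NM).
  rewrite ger0_norm ?sumr_ge0// -[N in leRHS]card_ord -sum1_card natr_sum.
  by apply: ler_sum => i _; rewrite indicE lern1 leq_b1.
Qed.

Lemma Rintegral_sum_indic N (F : nat -> set T) : (forall k, measurable (F k)) ->
  \int[mu]_x (\sum_(k < N) \1_(F k) x) = \sum_(k < N) fine (mu (F k)).
Proof.
move=> mF; elim: N => [|N ih].
  under eq_Rintegral do rewrite big_ord0.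
  by rewrite big_ord0 Rintegral_cst_probability.
under eq_Rintegral do rewrite big_ord_recr/=.
rewrite RintegralD//; last 2 first.
- exact: integrable_sum_indic.
- exact: integrable_indic.
rewrite ih big_ord_recr/=; congr (_ + _).
by rewrite /Rintegral integral_indic// setIT.
Qed.

(** Integration of [sum_levels_le] and [le_sum_levels] at h = N g(x); the error of one unit becomes
    1/N after division by [N]. The variable [S] only names the sum that occurs on both sides. *)
Lemma layer_cake (g : T -> R) N : measurable_fun [set: T] g ->
  (forall x, 0 <= g x <= 1) ->
  forall S, S = \sum_(k < N) fine (mu [set x | k.+1%:R <= N%:R * g x]) ->
  S <= N%:R * \int[mu]_x g x <= 1 + S.
Proof.
move=> mg g01 S ->.
have ig : mu.-integrable [set: T] (EFin \o g).
  apply: measurable_bounded_integrable => //.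
    by rewrite [ltLHS]probability_setT ltry.
  exists 1; split => // M M1 x _ /=; apply: le_trans (ltW M1).
  by have /andP[g0 g1] := g01 x; rewrite ger0_norm.
pose F k := [set x | k.+1%:R <= N%:R * g x].
have mF k : measurable (F k).
  rewrite /F -[X in measurable X]setTI.
  apply: (@measurable_fun_le _ _ _ _ (cst k.+1%:R)) => //.
  exact: measurable_funM.
have iF := integrable_sum_indic N mF.
have ics : mu.-integrable [set: T] (EFin \o (cst 1 : T -> R)).
  exact: finite_measure_integrable_cst.
rewrite -(Rintegral_sum_indic N mF) -RintegralZl//; apply/andP; split.
- apply: le_Rintegral => //.
    by apply: (integrableZl measurableT N%:R ig).
  move=> x _; under eq_bigr do rewrite indicE.
  have /andP[g0 g1] := g01 x.
  rewrite (le_trans _ (sum_levels_le N (mulr_ge0 (ler0n _ N) g0)))//.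
  by apply: ler_sum => k _; rewrite mem_setE.
- rewrite -[X in _ <= X + _](Rintegral_cst_probability mu) -RintegralD//.
  apply: le_Rintegral => //.
  + by apply: (integrableZl measurableT N%:R ig).
  + exact: (integrableD measurableT ics iF).
  move=> x _; under eq_bigr do rewrite indicE.
  have /andP[g0 g1] := g01 x.
  rewrite (le_trans (@le_sum_levels (N%:R * g x) N _))//.
    by rewrite ler_piMr.
  by rewrite lerD2l; apply: ler_sum => k _; rewrite mem_setE.
Qed.

End layer_cake.

(** The image filter lives on a compact segment and has a cluster point there. For each ball around
    it, an ultrafilter contains the preimage of the ball or that of its complement, and clustering
    excludes the latter. *)
Lemma ultra_bounded_cvg (R : realType) (T : Type) (F : set_system T)
    (phi : T -> R) (M : R) : UltraFilter F -> (forall t, `|phi t| <= M) ->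
  exists l : R, phi @ F --> l.
Proof.
move=> FU phiM; have FF : ProperFilter F by exact: ultra_proper.
have PF : ProperFilter (phi @ F) by exact: fmap_proper_filter.
have phi_itv : (phi @ F) `[- M, M]%classic.
  by apply: (@filterE _ F) => t; rewrite /= in_itv/= -ler_norml.
have [l [_ cl]] := segment_compact PF phi_itv.
exists l; apply/cvgrPdist_lt => e e0.
have [//|nF] := in_ultra_setVsetC [set t | `|l - phi t| < e] FU.
have [y [/= yF yl]] := cl (~` [set y | `|l - y| < e]) (ball l e) nF
  (nbhsx_ballx _ _ e0).
by case: yF.
Qed.

Lemma cvg_initial (S : choiceType) (T : topologicalType) (f : S -> T)
    (F : set_system S) (s : S) : Filter F ->
  f @ F --> f s -> F --> (s : initial_topology f).
Proof.
move=> FF fF A; rewrite nbhsE => -[_ [[B oB <-] Bfs] BA].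
by apply: filterS BA _; apply: fF; exact: open_nbhs_nbhs.
Qed.

Lemma cvg_ptws (U : choiceType) (V : topologicalType)
    (F : set_system {ptws U -> V}) (f : {ptws U -> V}) : Filter F ->
  (forall u, (fun g => g u) @ F --> f u) -> F --> f.
Proof.
move=> FF Ff; apply/cvg_sup => u; apply: cvg_initial; exact: Ff.
Qed.

Section weak_convergence.
Context (R : realType) (X : pointedMetricType R).
Hypothesis X_compact : compact [set: X].

Lemma compact_bounded_continuous (f : X -> R) : continuous f ->
  f \in (@bounded_continuous R X).
Proof.
by move=> cf; apply/mem_set; split => //; exact: compact_bounded_fun.
Qed.

Lemma cvg_weak_prob (F : set_system (probability (borel X) R)) (nu : weak_prob X) :
  Filter F -> (forall f : X -> R, continuous f ->
    (fun mu : probability (borel X) R => \int[mu]_x f x) @ F -->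
    \int[(nu : probability (borel X) R)]_x f x) -> F --> nu.
Proof.
move=> FF Fnu; apply: cvg_initial; apply: cvg_ptws => f; apply: Fnu.
by have /set_mem[] := valP f.
Qed.

Lemma continuous_integral (f : X -> R) : continuous f ->
  continuous ((fun mu : probability (borel X) R => \int[mu]_x f x) :
    weak_prob X -> R).
Proof.
move=> cf mu.
pose f' : @bounded_continuous R X := SigSub (compact_bounded_continuous cf).
pose g := @proj _ (fun=> R : topologicalType) f' \o (@pairing R X).
suff : {for mu, continuous (g : weak_prob X -> R)} by [].
apply: continuous_comp; first exact: initial_continuous.
exact: proj_continuous.
Qed.

(** * Weak limits of ultrafilters of probability measures *)

Section ultrafilter_limit.
Variable F : set_system (probability (borel X) R).
Context {FU : UltraFilter F}.

Let FF : ProperFilter F. Proof. exact: ultra_proper. Qed.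

(* The truncation makes the limit exist on non-measurable sets as well. *)
Let mass (mu : probability (borel X) R) (A : set (borel X)) : R :=
  Num.min 1 (fine (mu A)).

Let massE mu A : measurable A -> mass mu A = fine (mu A).
Proof.
move=> mA; apply/min_idPr; rewrite -lee_fin fineK ?fin_num_measure//.
exact: probability_le1.
Qed.

Let mass01 mu A : 0 <= mass mu A <= 1.
Proof. by rewrite /mass le_min ler01 ge_min lexx/= fine_ge0. Qed.

Let m (A : set (borel X)) : R := lim ((fun mu => mass mu A) @ F).

Let cvg_mass A : (fun mu => mass mu A) @ F --> m A.
Proof.
have [|l Fl] := @ultra_bounded_cvg R _ F (fun mu => mass mu A) 1 FU.
  by move=> mu; have /andP[? ?] := mass01 mu A; rewrite ger0_norm.
by apply/cvg_ex; exists l.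
Qed.

Let cvg_mass_fine A : measurable A ->
  (fun mu : probability (borel X) R => fine (mu A)) @ F --> m A.
Proof.
move=> mA; have := @cvg_mass A; rewrite (_ : (fun mu => mass mu A) =
  (fun mu : probability (borel X) R => fine (mu A)))//.
by apply/funext => mu; rewrite massE.
Qed.

Let exists_regularization : exists nu : probability (borel X) R,
  forall A : set X, closed A -> ((m A)%:E <= nu A)%E.
Proof.
apply: exists_borel_regularization => //.
- move=> A; apply: limr_ge; first by apply/cvg_ex; exists (m A); exact: cvg_mass.
  by apply: nearW => mu; have /andP[] := mass01 mu A.
- apply/cvg_lim => //; rewrite (_ : (fun mu => mass mu [set: X]) = cst 1).
    exact: cvg_cst.
  by apply/funext => mu; rewrite massE// [mu _]probability_setT.
- move=> A B mA mB AB0; apply/cvg_lim => //.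
  rewrite (_ : (fun mu => mass mu (A `|` B)) =
      (fun mu => mass mu A + mass mu B)); first exact: cvgD.
  apply/funext => mu; rewrite !massE//; last exact: measurableU.
  by rewrite measureU// fineD// fin_num_measure.
Qed.

(** The level sets of [g] are closed. The upper layer cake bound involves finitely many of them and
    passes to the limit along [F]; there [m] is replaced by the larger [nu], and the lower layer
    cake bound returns to the integral of [g]. The total error is 1/N. *)
Let lim_le (nu : probability (borel X) R) (g : X -> R) (l : R) :
  (forall A : set X, closed A -> ((m A)%:E <= nu A)%E) ->
  continuous g -> (forall x, 0 <= g x <= 1) ->
  (fun mu : probability (borel X) R => \int[mu]_x g x) @ F --> l ->
  l <= \int[nu]_x g x.
Proof.
move=> mnu cg g01 Fl.
pose A N k := [set x : X | k.+1%:R <= N%:R * g x].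
have cA N k : closed (A N k).
  apply: (@preimage_closed _ _ (fun x => N%:R * g x) [set y | k.+1%:R <= y]).
    by move=> x _; apply: cvgM; [exact: cvg_cst|exact: cg].
  exact: closed_ge.
have mA N k : measurable (A N k : set (borel X)) by exact: closed_borel.
have mg := continuous_borel cg.
have key N : N%:R * l <= 1 + N%:R * \int[nu]_x g x.
  apply: (@le_trans _ _ (1 + \sum_(k < N) m (A N k))).
    have cl : (fun mu : probability (borel X) R => N%:R * \int[mu]_x g x) @ F
        --> N%:R * l by apply: cvgM => //; exact: cvg_cst.
    have cr : (fun mu : probability (borel X) R =>
        1 + \sum_(k < N) fine (mu (A N k))) @ F --> 1 + \sum_(k < N) m (A N k).
      apply: cvgD; first exact: cvg_cst.
      by apply: cvg_big => [|k _]; [exact: add_continuous|exact: cvg_mass_fine].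
    have /(_ FF) cd := cvgB cr cl; rewrite -subr_ge0 -(cvg_lim _ cd)//.
    apply: limr_ge; first by apply/cvg_ex; eexists; exact: cd.
    apply: nearW => mu; rewrite subr_ge0.
    by have /andP[] := @layer_cake R _ _ mu g N mg g01 _ erefl.
  rewrite lerD2l; have /andP[+ _] := @layer_cake R _ _ nu g N mg g01 _ erefl.
  apply: le_trans; apply: ler_sum => k _.
  rewrite -lee_fin fineK; first exact: (mnu (A N k)).
  by apply: fin_num_measure; exact: (mA N k).
rewrite leNgt; apply/negP => lnu.
have [N] := ltr_add_invr lnu.
move: (key N.+1); set J := Rintegral _ _ _ => keyN JN.
have : N.+1%:R * (J + N.+1%:R^-1) < N.+1%:R * l by rewrite ltr_pM2l.
by rewrite mulrDr divff ?pnatr_eq0// addrC ltNge keyN.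
Qed.

Lemma ultrafilter_cvg_weak_prob : exists nu : weak_prob X, F --> nu.
Proof.
have [nu mnu] := exists_regularization.
exists nu; apply: cvg_weak_prob => f cf.
have [M M0 fM] := compact_bound X_compact cf.
have [|l Fl] := @ultra_bounded_cvg R _ F
    (fun mu : probability (borel X) R => \int[mu]_x f x) M FU.
  by move=> mu; exact: norm_Rintegral_le.
suff -> : \int[nu]_x f x = l by [].
(* The inequality of [lim_le] is one-sided; applying it to both [f] and [- f] gives equality. *)
have step (s : R) : `|s| = 1 -> s * l <= s * \int[nu]_x f x.
  move=> s1.
  (* Since |f| <= M, the function c f + 1/2 takes its values in [0, 1]. *)
  pose c := (2 * M)^-1 * s.
  pose g x := c * f x + 2^-1.
  have ccf : continuous (fun x => c * f x).
    by move=> x; apply: cvgM; [exact: cvg_cst|exact: cf].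
  have cg : continuous g.
    by move=> x; apply: cvgD; [exact: ccf|exact: cvg_cst].
  have intg (mu : probability (borel X) R) :
      \int[mu]_x g x = c * \int[mu]_x f x + 2^-1.
    rewrite RintegralD//; last 2 first.
    - exact: continuous_integrable.
    - exact: finite_measure_integrable_cst.
    rewrite Rintegral_cst_probability RintegralZl//.
    exact: continuous_integrable.
  have g01 x : 0 <= g x <= 1.
    have : `|c * f x| <= 2^-1.
      rewrite !normrM s1 mulr1 gtr0_norm ?invr_gt0 ?mulr_gt0// invfM -mulrA.
      by rewrite ler_piMr ?invr_ge0// mulrC ler_pdivrMr// mul1r.
    rewrite ler_norml /g; lra.
  have cvgg : (fun mu : probability (borel X) R => \int[mu]_x g x) @ F -->
      c * l + 2^-1.
    under eq_fun do rewrite intg.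
    apply: cvgD; last exact: cvg_cst.
    by apply: cvgM; first exact: cvg_cst.
  have := lim_le mnu cg g01 cvgg.
  by rewrite intg lerD2r -!mulrA ler_pM2l// invr_gt0 mulr_gt0.
apply/eqP; rewrite eq_le; apply/andP; split.
  by rewrite -lerN2 -[leLHS]mulN1r -[leRHS]mulN1r; apply: step; rewrite normrN1.
by rewrite -[l]mul1r -[leRHS]mul1r; apply: step; rewrite normr1.
Qed.

End ultrafilter_limit.

Lemma compact_weak_prob : compact [set: weak_prob X].
Proof.
rewrite compact_ultra => F FU _.
by have [nu Fnu] := ultrafilter_cvg_weak_prob (FU := FU); exists nu.
Qed.

End weak_convergence.

(** * The law of the empirical measure *)

Section integrals_of_probabilities.
Context d (T : measurableType d) (R : realType).

Lemma bounded_integrable (mu : probability T R) (f : T -> R) M :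
  measurable_fun [set: T] f -> (forall x, `|f x| <= M) ->
  mu.-integrable [set: T] (EFin \o f).
Proof.
move=> mf fM; apply: measurable_bounded_integrable => //.
  by rewrite [ltLHS]probability_setT ltry.
exists M; split; first exact: num_real.
by move=> N MN x _; exact: (le_trans (fM x) (ltW MN)).
Qed.

(* Reduces an affine identity between integrals to nonnegative integrands. *)
Lemma Rintegral_shift (mu : probability T R) (f : T -> R) M :
  measurable_fun [set: T] f -> (forall x, `|f x| <= M) ->
  \int[mu]_x f x = fine (\int[mu]_x (f x + M)%:E)%E - M.
Proof.
move=> mf fM; rewrite -/(Rintegral mu _ (fun x => f x + M)) RintegralD//.
- by rewrite Rintegral_cst_probability addrK.
- exact: bounded_integrable fM.
- exact: finite_measure_integrable_cst.
Qed.

Lemma Rintegral_mixture (t : {i01 R}) (mu nu : probability T R) (f : T -> R) M :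
  measurable_fun [set: T] f -> (forall x, `|f x| <= M) ->
  \int[mixture t mu nu]_x f x =
  t%:num * \int[mu]_x f x + (1 - t%:num) * \int[nu]_x f x.
Proof.
move=> mf fM; rewrite !(@Rintegral_shift _ f M)//.
have mfM : measurable_fun [set: T] (fun x => (f x + M)%:E).
  by apply/measurable_EFinP; exact: measurable_funD.
have fM0 x : [set: T] x -> (0 <= (f x + M)%:E)%E.
  move=> _; rewrite lee_fin -lerBlDr sub0r.
  by have := fM x; rewrite ler_norml => /andP[].
have fin (P : probability T R) : (\int[P]_x (f x + M)%:E)%E \is a fin_num.
  apply: integrable_fin_num => //; apply: (@bounded_integrable _ _ (M + M)).
    exact: measurable_funD.
  move=> x; have := fM x; rewrite !ler_norml; lra.
rewrite ge0_integral_measure_add// !ge0_integral_mscale//=.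
rewrite fineD ?fin_numM// !fineM//=; lra.
Qed.

Lemma Rintegral_empirical n (n_gt0 : (0 < n)%N) (x : nat -> T) (f : T -> R) M :
  measurable_fun [set: T] f -> (forall x, `|f x| <= M) ->
  \int[empirical n_gt0 x]_y f y = n%:R^-1 * \sum_(k < n) f (x k).
Proof.
move=> mf fM; rewrite !(@Rintegral_shift _ f M)//.
have mfM : measurable_fun [set: T] (fun x => (f x + M)%:E).
  by apply/measurable_EFinP; exact: measurable_funD.
have fM0 y : [set: T] y -> (0 <= (f y + M)%:E)%E.
  move=> _; rewrite lee_fin -lerBlDr sub0r.
  by have := fM y; rewrite ler_norml => /andP[].
rewrite ge0_integral_mscale//= ge0_integral_measure_sum//=.
under eq_bigr do rewrite integral_dirac//= diracT mul1e.
rewrite sumEFin -EFinM/= big_split/= mulrDr sumr_const card_ord.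
by rewrite -[M *+ n]mulr_natl mulKf ?addrK// pnatr_eq0 -lt0n.
Qed.

End integrals_of_probabilities.

Section empirical_event.
Context (R : realType) (X : pointedMetricType R).
Hypothesis X_compact : compact [set: X].

Lemma continuous_Rintegral_empirical n (n_gt0 : (0 < n)%N) (x : nat -> borel X)
  (f : X -> R) : continuous f ->
  \int[empirical n_gt0 x]_y f y = n%:R^-1 * \sum_(k < n) f (x k).
Proof.
move=> cf; have [M _ fM] := compact_bound X_compact cf.
exact: (Rintegral_empirical n_gt0 x (continuous_borel cf) fM).
Qed.

(** The weak topology does not separate [mu] from [nu]: every neighbourhood of [nu] contains [mu].
    This makes it possible to change the sequence that represents an empirical measure. *)
Lemma closed_weak_prob_indistinguishable (C : set (probability (borel X) R))
    (mu nu : probability (borel X) R) : closed (C : set (weak_prob X)) ->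
  (forall f : X -> R, continuous f -> \int[mu]_x f x = \int[nu]_x f x) ->
  C mu -> C nu.
Proof.
move=> cC munu Cmu; apply: (cC nu) => B; rewrite nbhsE => -[_ [[A oA <-] Anu] AB].
exists mu; split=> //; apply: AB => /=; rewrite (_ : pairing mu = pairing nu)//.
by apply/funext => f; apply: munu; have /set_mem[] := valP f.
Qed.

(** The padding by [point] is harmless, because [empirical] reads only the first [n] terms of its
    sequence. *)
Let seq_of_row n (x : 'rV[X]_n) (k : nat) : borel X :=
  oapp (x ord0) point (insub k).

Let empirical_row n (n_gt0 : (0 < n)%N) (x : 'rV[X]_n) :
  probability (borel X) R := empirical n_gt0 (seq_of_row x).

Let empirical_row_continuous n (n_gt0 : (0 < n)%N) :
  continuous (empirical_row n_gt0 : 'rV[X]_n -> weak_prob X).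
Proof.
move=> x.
apply: (cvg_weak_prob (fmap_filter (empirical_row n_gt0) (nbhs_filter x))).
move=> f cf.
have intE y : \int[empirical_row n_gt0 y]_z f z =
    n%:R^-1 * \sum_(k < n) f (y ord0 k).
  rewrite continuous_Rintegral_empirical//; congr (_ * _).
  by apply: eq_bigr => k _; rewrite /seq_of_row valK.
rewrite intE.
suff : (fun y => \int[empirical_row n_gt0 y]_z f z) @ nbhs x -->
    n%:R^-1 * \sum_(k < n) f (x ord0 k) by [].
rewrite (funext intE).
apply: cvgM; first exact: cvg_cst.
apply: cvg_big => [|k _]; first exact: add_continuous.
apply: (@cvg_comp _ _ _ (fun x : 'rV[X]_n => x ord0 k) f _ (nbhs (x ord0 k))).
  move=> A xA; exists (fun i j => if j == k then A else setT) => [i j /=|y /=].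
    by rewrite ord1; case: eqP => [->//|_]; exact: filterT.
  by move=> /(_ ord0 k); rewrite eqxx.
exact: cf.
Qed.

(** The question is moved to rows of [n] points, where the rows whose empirical measure is outside
    [C] form an open set. As X is compact metric, hence second countable, this set is a countable
    union of open boxes, whose preimages are finite intersections of measurable events. *)
Lemma measurable_empirical_event d (Omega : measurableType d)
    (Y : nat -> Omega -> borel X) n (n_gt0 : (0 < n)%N)
    (C : set (probability (borel X) R)) :
  (forall k, measurable_fun [set: Omega] (Y k)) ->
  closed (C : set (weak_prob X)) ->
  measurable [set w | C (empirical n_gt0 (Y ^~ w))].
Proof.
move=> mY cC.
pose row w : 'rV[X]_n := \row_i Y i w.
have rowE w : C (empirical n_gt0 (Y ^~ w)) <->
    C (empirical_row n_gt0 (row w)).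
  have E (f : X -> R) : continuous f ->
      \int[empirical n_gt0 (Y ^~ w)]_x f x =
      \int[empirical_row n_gt0 (row w)]_x f x.
    move=> cf; rewrite !continuous_Rintegral_empirical//; congr (_ * _).
    by apply: eq_bigr => k _; rewrite /seq_of_row valK/= mxE.
  by split; apply: closed_weak_prob_indistinguishable => // f /E ->.
pose D : set 'rV[X]_n := [set x | ~ C (empirical_row n_gt0 x)].
have oD : open D.
  have oC : open (~` C : set (weak_prob X)) by exact: closed_openC.
  exact: ((continuousP _).1 (@empirical_row_continuous n n_gt0) _ oC).
have [B /pfcard_geP Bcount [oB Bnbhs]] := compact_second_countable X_compact.
have [b [ob Bb]] : exists b : nat -> set X, (forall k, open (b k)) /\
    forall U, B U -> exists k, b k = U.
  case: Bcount => [B0|[f]].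
    by exists (fun=> set0); split => [k|U]; [exact: open0|rewrite B0].
  exists f; split => [k|U /(@surj _ _ _ _ f)[k _ <-]]; last by exists k.
  by apply: oB; exact: funS.
pose box (phi : {ffun 'I_n -> nat}) := [set x : 'rV[X]_n |
  forall i, b (phi i) (x ord0 i)].
(* Boxes are enumerated through the codes of their indices; a code without a meaning, or whose box
   leaves [D], contributes the empty set. *)
pose boxD k := if (choice.unpickle k : option {ffun 'I_n -> nat}) is Some phi then
  if `[< box phi `<=` D >] then box phi else set0 else set0.
have DE : D = \bigcup_k boxD k.
  apply/seteqP; split => [x Dx|x [k _]]; last first.
    rewrite /boxD; case: (choice.unpickle k) => // phi.
    by case: asboolP => // phiD; exact: phiD.
  have /= : nbhs x D by exact: open_nbhs_nbhs.
  case=> P Px PD.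
  have /choice[phi phiP] (i : 'I_n) : exists k, b k (x ord0 i) /\
      b k `<=` P ord0 i.
    have [U [BU Ux] UP] := Bnbhs (x ord0 i) _ (Px ord0 i).
    by have [k bk] := Bb _ BU; exists k; rewrite bk.
  exists (choice.pickle [ffun i => phi i]) => //.
  rewrite /boxD choice.pickleK asboolT => [i|y yphi].
    by rewrite ffunE; case: (phiP i).
  apply: PD => i j; rewrite ord1; have [_] := phiP j; apply.
  by have := yphi j; rewrite ffunE.
rewrite (_ : [set w | _] = ~` (row @^-1` D)); last first.
  apply/seteqP; split => w /=; first by move=> /rowE ?; apply.
  by move=> /contrapT /rowE.
apply: measurableC; rewrite DE preimage_bigcup; apply: bigcupT_measurable => k.
rewrite /boxD; case: (choice.unpickle k) => [phi|]; last by rewrite preimage_set0.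
case: asboolP => _; last by rewrite preimage_set0.
rewrite (_ : _ @^-1` _ =
    \bigcap_(i in [set: 'I_n]) (Y i @^-1` b (phi i))); last first.
  apply/seteqP; split => w /=.
    by move=> wb i _; have := wb i; rewrite mxE.
  by move=> wb i; rewrite mxE; exact: wb.
apply: fin_bigcap_measurable => [|i _]; first exact: finite_finset.
rewrite -[X in measurable X]setTI.
by apply: mY => //; exact: open_borel.
Qed.

End empirical_event.

(** * Markov chains *)

Section integral_mrestr.
Context d (T : measurableType d) (R : realType) (mu : {measure set T -> \bar R}).
Local Open Scope ereal_scope.

Lemma ge0_integral_mrestr (A : set T) (mA : measurable A) (f : T -> \bar R) :
  measurable_fun [set: T] f -> (forall x, 0 <= f x) ->
  \int[mrestr mu mA]_x f x = \int[mu]_(x in A) f x.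
Proof.
move=> mf f0; rewrite -(setUv A) ge0_integral_setU//.
- rewrite [X in _ + X](_ : _ = 0) ?adde0.
    by apply: eq_measure_integral => B mB BA; rewrite /= /mrestr (setIidl BA).
  rewrite (@eq_measure_integral _ _ _ _ mzero) ?integral_measure_zero//.
  move=> B mB BA; rewrite /= /mrestr (_ : B `&` A = set0) ?measure0//.
  by rewrite -subset0 => x [/BA].
- exact: measurableC.
- by rewrite setUv.
- by apply/disj_setPS => x [].
Qed.

End integral_mrestr.

Section constant_kernel.
Context d d' (T : measurableType d) (U : measurableType d') (R : realType).
Variables (mu : {measure set U -> \bar R}) (mu_fin : (mu [set: U] < +oo)%E).

(** A finite measure seen as a kernel, so that composition of kernels and its integration formula
    apply to the law of a single variable. The proof of finiteness is an argument so that the finite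
    kernel instance can be attached. *)
Definition kconst of (mu [set: U] < +oo)%E :=
  fun _ : T => mu : {measure set U -> \bar R}.

Let measurable_kconst B : measurable B ->
  measurable_fun [set: T] (kconst mu_fin ^~ B).
Proof. by move=> _; exact: measurable_cst. Qed.

HB.instance Definition _ :=
  isKernel.Build _ _ T U R (kconst mu_fin) measurable_kconst.

Let kconst_uub : measure_fam_uub (kconst mu_fin).
Proof.
have muT : mu setT \is a fin_num by rewrite ge0_fin_numE.
exists (fine (mu setT) + 1) => t.
by rewrite /kconst -[ltLHS]fineK// lte_fin ltrDl.
Qed.

HB.instance Definition _ :=
  Kernel_isFinite.Build _ _ T U R (kconst mu_fin) kconst_uub.

End constant_kernel.

Section integral_conditional_law.
Context d (T : measurableType d) d' (Omega : measurableType d') (R : realType).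
Variables (P : probability Omega R) (K : R.-pker T ~> T) (Y Z : Omega -> T).
Hypotheses (mY : measurable_fun [set: Omega] Y)
  (mZ : measurable_fun [set: Omega] Z).
Local Open Scope ereal_scope.

(** Under [P] restricted to [A], the hypothesis says that the law of [Z] is the law of [Y] composed
    with [K]. The integration formula for composed kernels then passes from sets to nonnegative
    functions. *)
Lemma integral_conditional_law A (mA : measurable A) :
  (forall B, measurable B -> P (A `&` Z @^-1` B) = \int[P]_(w in A) K (Y w) B) ->
  forall g : T -> \bar R, (forall x, 0 <= g x) -> measurable_fun [set: T] g ->
  \int[P]_(w in A) g (Z w) = \int[P]_(w in A) (\int[K (Y w)]_x g x).
Proof.
move=> PAZ g g0 mg.
pose PA : {measure set Omega -> \bar R} := mrestr P mA.
pose law f (mf : measurable_fun [set: Omega] f) : {measure set T -> \bar R} :=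
  measure_function_pushforward__canonical__measure_function_Measure PA mf.
have law_fin : law Y mY [set: T] < +oo.
  rewrite /= /pushforward /PA/= /mrestr preimage_setT setTI.
  by rewrite (le_lt_trans (probability_le1 _ mA))// ltry.
pose l : R.-fker unit ~> T := kconst law_fin.
pose k : R.-fker unit * T ~> T := kernel.kernel_snd K.
have mK B : measurable B -> measurable_fun [set: T] (K ^~ B).
  by move=> mB; exact: measurable_kernel.
have mKg : measurable_fun [set: T] (fun y => \int[K y]_x g x).
  by apply: measurable_fun_integral_kernel => // B mB; exact: mK.
rewrite -(ge0_integral_mrestr P mA); last 2 first.
- exact: measurableT_comp.
- by move=> w; exact: g0.
rewrite -[RHS](ge0_integral_mrestr P mA); last 2 first.
- exact: (measurableT_comp mKg mY).
- by move=> w; exact: integral_ge0.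
transitivity (\int[law Z mZ]_x g x).
  by rewrite ge0_integral_pushforward// => x _.
transitivity (\int[kcomp l k tt]_x g x).
  apply: eq_measure_integral => B mB _.
  rewrite /= /pushforward/= /mrestr setIC PAZ//.
  rewrite -(ge0_integral_mrestr P mA) => [||w]; last exact: measure_ge0.
    by rewrite /kcomp ge0_integral_pushforward//; exact: mK.
  exact: (measurableT_comp (mK B mB) mY).
rewrite integral_kcomp// ge0_integral_pushforward// => y _.
exact: integral_ge0.
Qed.

End integral_conditional_law.

Import HBNNSimple.

(** * Functions with the same integrals over a sub-sigma-algebra *)

Section integral_sub_sigma_algebra.
Context d (Omega : measurableType d) (R : realType).
Variables (mu : {measure set Omega -> \bar R}) (G : set (set Omega)).
Hypothesis G_measurable : forall A, <<s G >> A -> measurable A.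

Let sub_measurable (h : Omega -> R) :
  measurable_fun [set: g_sigma_algebraType G] (h : g_sigma_algebraType G -> R) ->
  measurable_fun [set: Omega] h.
Proof.
move=> mh _ B mB; rewrite setTI; apply: G_measurable.
by have := mh measurableT B mB; rewrite setTI.
Qed.

Let nnsfun_preimage (h : {nnsfun g_sigma_algebraType G >-> R}) r :
  <<s G >> (h @^-1` [set r]).
Proof.
have mh : measurable_fun setT h by [].
have := mh measurableT [set r] (measurable_set1 r).
by rewrite setTI.
Qed.

Let integral_nnsfun_mul (h : {nnsfun g_sigma_algebraType G >-> R})
    (f : Omega -> R) : (forall x, 0 <= f x) -> measurable_fun [set: Omega] f ->
  (\int[mu]_x (h x * f x)%:E =
   \sum_(r \in range h) (r%:E * \int[mu]_(x in h @^-1` [set r]) (f x)%:E))%E.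
Proof.
move=> f0 mf.
have mhr r : measurable (h @^-1` [set r] : set Omega).
  by apply: G_measurable; exact: nnsfun_preimage.
have E x : (h x * f x)%:E =
    (\sum_(r \in range h) (r%:E * ((f \_ (h @^-1` [set r])) x)%:E))%E.
  rewrite [in LHS](fimfunE h) mulr_fsuml// -fsumEFin//.
  by apply: eq_fsbigr => r _; rewrite patchE indicE; case: ifPn => hxr;
    rewrite ?mulr1// mulr0 mul0r mule0.
under eq_integral do rewrite E.
rewrite ge0_integral_fsum//; last 2 first.
- move=> r; apply: measurable_funeM; apply/measurable_EFinP.
  by apply/(measurable_restrict _ (mhr r) measurableT); exact: measurable_funTS.
- move=> r x _; rewrite -EFinM lee_fin patchE; case: ifPn => [/set_mem <-|_].
    by rewrite mulr_ge0.
  by rewrite mulr0.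
apply: eq_fsbigr => r /set_mem[x _ <-].
rewrite ge0_integralZl//; last 3 first.
- apply/measurable_EFinP/(measurable_restrictT _ (mhr _)).
  exact: measurable_funTS.
- by move=> y _; rewrite lee_fin patchE; case: ifPn.
- by rewrite lee_fin.
by rewrite [in RHS]integral_mkcond restrict_EFin.
Qed.

Let cvg_integral_mul (h f : Omega -> R)
    (hn : {nnsfun g_sigma_algebraType G >-> R}^nat) :
  (forall x, 0 <= f x) -> measurable_fun [set: Omega] f ->
  (forall x, {homo (fun n => hn n x) : n m / (n <= m)%N >-> n <= m}) ->
  (forall x, hn ^~ x @ \oo --> h x) ->
  ((\int[mu]_x (hn n x * f x)%:E) @[n --> \oo] --> \int[mu]_x (h x * f x)%:E)%E.
Proof.
move=> f0 mf hn_nd hnh.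
have -> : (\int[mu]_x (h x * f x)%:E =
    \int[mu]_x (limn (fun n => (hn n x * f x)%:E)))%E.
  apply: eq_integral => x _; apply/esym/cvg_lim => //.
  by apply: cvg_EFin; [exact: nearW|apply: cvgM; [exact: hnh|exact: cvg_cst]].
apply: cvg_monotone_convergence => //.
- move=> n; apply/measurable_EFinP; apply: measurable_funM => //.
  by apply: sub_measurable; exact: measurable_funP.
- by move=> n x _; rewrite lee_fin mulr_ge0.
- by move=> x _ n k nk; rewrite lee_fin ler_wpM2r// hn_nd.
Qed.

(** For simple [h] this is linearity, the level sets of [h] belonging to the sub-sigma-algebra; the
    general case follows by monotone convergence. *)
Lemma eq_integral_mul_sub_sigma_algebra (h f1 f2 : Omega -> R) :
  (forall x, 0 <= f1 x) -> (forall x, 0 <= f2 x) ->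
  measurable_fun [set: Omega] f1 -> measurable_fun [set: Omega] f2 ->
  (forall A, <<s G >> A ->
    \int[mu]_(x in A) (f1 x)%:E = \int[mu]_(x in A) (f2 x)%:E)%E ->
  (forall x, 0 <= h x) ->
  measurable_fun [set: g_sigma_algebraType G] (h : g_sigma_algebraType G -> R) ->
  (\int[mu]_x (h x * f1 x)%:E = \int[mu]_x (h x * f2 x)%:E)%E.
Proof.
move=> f10 f20 mf1 mf2 f12 h0 mh.
have mEh : measurable_fun [set: g_sigma_algebraType G]
  (EFin \o (h : g_sigma_algebraType G -> R)) by exact/measurable_EFinP.
pose hn := nnsfun_approx measurableT mEh.
have hn_nd x : {homo (fun n => hn n x) : n m / (n <= m)%N >-> n <= m}.
  by move=> n k nk; exact/lefP/nd_nnsfun_approx.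
have hnh x : hn ^~ x @ \oo --> h x.
  have Eh0 y : [set: g_sigma_algebraType G] y -> (0 <= (EFin \o h) y)%E.
    by move=> _; rewrite lee_fin.
  exact: (fine_cvg (cvg_nnsfun_approx measurableT mEh Eh0 (x := x) I)).
have := cvg_integral_mul f20 mf2 hn_nd hnh.
have -> : (fun n => \int[mu]_x (hn n x * f2 x)%:E)%E =
    (fun n => \int[mu]_x (hn n x * f1 x)%:E)%E.
  apply/funext => n; rewrite !integral_nnsfun_mul//.
  apply: eq_fsbigr => r _; rewrite f12//.
move/cvg_lim => <- //; apply/esym/cvg_lim => //.
exact: cvg_integral_mul.
Qed.

End integral_sub_sigma_algebra.

Lemma g_sigma_preimage_measurable d (T : measurableType d) d' (U : measurableType d')
    n (f : 'I_n -> T -> U) : (forall i, measurable_fun [set: T] (f i)) ->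
  forall A, g_sigma_preimage f A -> measurable A.
Proof.
move=> mf; apply: smallest_sub; first exact: sigma_algebra_measurable.
elim/big_ind : _ => [|F G FA GA|i _].
- by move=> ?.
- by move=> A [/FA|/GA].
- by move=> _ [B mB <-]; exact: mf.
Qed.

(** * The exponential martingale of a Markov chain *)

Section markov_chain_expectation.
Context d (T : measurableType d) d' (Omega : measurableType d') (R : realType).
Variables (K : R.-pker T ~> T) (P : T -> probability Omega R)
  (Y : nat -> Omega -> T).
Hypothesis Y_markov : markov_chain K P Y.
Variables (u : T -> R) (a b : R).
Hypotheses (mu : measurable_fun [set: T] u) (a0 : 0 < a)
  (uab : forall x, a <= u x <= b).
Local Notation pi := (transition_op P Y u).

Let mY n : measurable_fun [set: Omega] (Y n).
Proof. by case: Y_markov. Qed.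

Let u_gt0 x : 0 < u x.
Proof. by apply: lt_le_trans a0 _; case/andP: (uab x). Qed.

Let uE0 x : (0 <= (u x)%:E)%E. Proof. by rewrite lee_fin ltW. Qed.

Let muE : measurable_fun [set: T] (EFin \o u).
Proof. exact/measurable_EFinP. Qed.

(** The Markov property at time 0 on the whole space, with [Y 0] almost surely equal to [x], shows
    that [Y 1] has law [K x]. The bound [b] makes the integral finite, so that [fine] in
    [transition_op] loses nothing. *)
Let integral_kernelE x : (\int[K x]_y (u y)%:E = (pi x)%:E)%E.
Proof.
have [_ Y0 YK] := Y_markov.
have mK : measurable_fun [set: T] (fun y => \int[K y]_z (u z)%:E)%E.
  by apply: measurable_fun_integral_kernel => // B mB; exact: measurable_kernel.
have key : (\int[P x]_w (u (Y 1%N w))%:E = \int[K x]_y (u y)%:E)%E.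
  have PA B : measurable B -> (P x (setT `&` Y 1%N @^-1` B) =
      \int[P x]_(w in setT) K (Y 0%N w) B)%E.
    move=> mB; apply: YK => //; rewrite -setC0.
    by apply: sigma_algebraC; exact: sigma_algebra0.
  rewrite (integral_conditional_law (mY 0%N) (mY 1%N) measurableT PA uE0 muE).
  transitivity (\int[P x]_w (cst (\int[K x]_y (u y)%:E) w))%E.
    apply: ae_eq_integral => //.
    - exact: (measurableT_comp mK (mY 0%N)).
    - by apply: filterS (Y0 x) => w -> _.
  by rewrite integral_cst//= probability_setT mule1.
rewrite /transition_op unlock key fineK//.
rewrite ge0_fin_numE ?integral_ge0//.
apply: (@le_lt_trans _ _ (\int[K x]_y b%:E)%E).
  apply: ge0_le_integral => //.
  by move=> y _; rewrite lee_fin; case/andP: (uab y).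
by rewrite integral_cst//= prob_kernel mule1 ltry.
Qed.

Lemma transition_op_bounds x : a <= pi x <= b.
Proof.
rewrite -!lee_fin -integral_kernelE.
have cstE (c : R) : (c%:E = \int[K x]_y c%:E)%E.
  by rewrite integral_cst//= prob_kernel mule1.
rewrite [X in (X <= _ <= _)%E]cstE [X in (_ <= _ <= X)%E]cstE.
apply/andP; split; apply: ge0_le_integral => //.
- by move=> y _; rewrite lee_fin ltW.
- by move=> y _; rewrite lee_fin; case/andP: (uab y).
- by move=> y _; rewrite lee_fin; case/andP: (uab y).
Qed.

Lemma transition_op_gt0 x : 0 < pi x.
Proof. by apply: lt_le_trans a0 _; case/andP: (transition_op_bounds x). Qed.

Lemma measurable_transition_op : measurable_fun [set: T] (pi : T -> R).
Proof.
apply/measurable_EFinP; rewrite (_ : EFin \o _ =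
    (fun x => \int[K x]_y (u y)%:E)%E).
  by apply: measurable_fun_integral_kernel => // B mB; exact: measurable_kernel.
by apply/funext => x; rewrite integral_kernelE.
Qed.

Lemma measurable_inv_transition_op d0 (S : measurableType d0) (f : S -> T) :
  measurable_fun [set: S] f ->
  measurable_fun [set: S] (fun s => (pi (f s))^-1).
Proof.
(* The inverse of a positive number is written as exp (- ln), a composition of measurable
   functions. *)
move=> mf; rewrite (_ : (fun _ => _) = expR \o -%R \o (@ln R \o (pi \o f))).
  apply: measurableT_comp; first exact: measurableT_comp.
  apply: measurableT_comp; first exact: measurable_ln.
  exact: (measurableT_comp measurable_transition_op mf).
apply/funext => w /=; rewrite expRN lnK// posrE.
exact: transition_op_gt0.
Qed.

Lemma measurable_prod_ratio d0 (S : measurableType d0) (f : nat -> S -> T) n :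
  (forall k, (k <= n)%N -> measurable_fun [set: S] (f k)) ->
  measurable_fun [set: S] (fun s => \prod_(k < n) (u (f k.+1 s) / pi (f k s))).
Proof.
move=> mf; apply: measurable_prod => k _; apply: measurable_funM.
  by apply: (measurableT_comp mu); exact: mf.
by apply/measurable_inv_transition_op/mf; exact: ltnW.
Qed.

(** Generators of the past up to time [n] included, in the unfolded form of the sigma-algebra that
    occurs in [markov_chain]. *)
Let F n : set (set Omega) :=
  \big[setU/set0]_(i < n.+1) preimage_set_system setT (Y i) measurable.

Let F_measurable n A : <<s F n >> A -> measurable A.
Proof. by apply: (@g_sigma_preimage_measurable _ _ _ _ n.+1 (fun i => Y i)). Qed.

Let mY_F n k : (k <= n)%N ->
  measurable_fun [set: g_sigma_algebraType (F n)]
    (Y k : g_sigma_algebraType (F n) -> T).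
Proof.
move=> kn _ B mB; apply: sub_sigma_algebra.
have kn1 : (k < n.+1)%N by [].
by rewrite /F (bigD1 (Ordinal kn1))//=; left; exists B.
Qed.

Lemma expectation_markov_step x n (h : Omega -> R) : (forall w, 0 <= h w) ->
  measurable_fun [set: g_sigma_algebraType (F n)]
    (h : g_sigma_algebraType (F n) -> R) ->
  (\int[P x]_w (h w * u (Y n.+1 w))%:E = \int[P x]_w (h w * pi (Y n w))%:E)%E.
Proof.
move=> h0 mh; apply: (eq_integral_mul_sub_sigma_algebra (@F_measurable n)) => //.
- by move=> w; exact: ltW.
- by move=> w; exact/ltW/transition_op_gt0.
- exact: (measurableT_comp mu (mY _)).
- exact: (measurableT_comp measurable_transition_op (mY _)).
move=> A FA; have mA := F_measurable FA.
have PA B : measurable B -> (P x (A `&` Y n.+1 @^-1` B) =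
    \int[P x]_(w in A) K (Y n w) B)%E by case: Y_markov => _ _; apply.
rewrite (integral_conditional_law (mY n) (mY n.+1) mA PA uE0 muE).
by apply: eq_integral => w _; rewrite integral_kernelE.
Qed.

Lemma expectation_exponential_martingale x n :
  (\int[P x]_w (\prod_(k < n) (u (Y k.+1 w) / pi (Y k w)))%:E = 1)%E.
Proof.
elim: n => [|n ih].
  under eq_integral do rewrite big_ord0.
  by rewrite integral_cst//= probability_setT mule1.
(* The denominator of the last factor depends on the past up to time [n] and is put into [h]; the
   new factor [u (Y n.+1 w)] is then averaged to [pi (Y n w)] and cancels it. *)
pose h w := (\prod_(k < n) (u (Y k.+1 w) / pi (Y k w))) / pi (Y n w).
transitivity (\int[P x]_w (h w * u (Y n.+1 w))%:E)%E.
  apply: eq_integral => w _; rewrite big_ord_recr/= /h; congr EFin; ring.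
rewrite expectation_markov_step.
- rewrite -[RHS]ih; apply: eq_integral => w _; rewrite /h divfK//.
  by rewrite gt_eqF// transition_op_gt0.
- move=> w; rewrite /h divr_ge0//; last exact/ltW/transition_op_gt0.
  by apply: prodr_ge0 => k _; rewrite divr_ge0// ltW// transition_op_gt0.
- apply: measurable_funM; last by apply: measurable_inv_transition_op; exact: mY_F.
  by apply: measurable_prod_ratio => k; exact: mY_F.
Qed.

End markov_chain_expectation.

(** * Change of measure by a fixed positive function *)

Section uniform_upper_bound.
Context (R : realType) (X : pointedMetricType R).
Hypothesis X_compact : compact [set: X].
Context d (Omega : measurableType d).
Variables (K : R.-pker (borel X) ~> (borel X))
  (P : borel X -> probability Omega R) (Y : nat -> Omega -> borel X).
Hypothesis Y_markov : markov_chain K P Y.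
Hypothesis Y_feller : forall u : X -> R, continuous u -> bounded_fun u ->
  continuous (transition_op P Y u : X -> R).

(** The lower bound is given as a value of [u] because the minimum point also serves as the starting
    point of the chain. *)
Lemma continuous_positive_bounds (u : X -> R) : continuous u ->
  (forall x, 0 < u x) -> exists x0 b, forall x, u x0 <= u x <= b.
Proof.
move=> cu u0.
have X0 : [set: X] !=set0 by exists point.
have [x0 _ ux0] := compact_EVT_min X0 X_compact (continuous_subspaceT cu).
have [b _ ub] := compact_bound X_compact cu.
exists x0, b => x; apply/andP; split; first exact/ux0/mem_set.
exact: (le_trans (ler_norm _) (ub x)).
Qed.

Lemma transition_op_continuous (u : X -> R) : continuous u ->
  continuous (transition_op P Y u : X -> R).
Proof. by move=> cu; apply: Y_feller => //; exact: compact_bounded_fun. Qed.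

Lemma transition_op_positive (u : X -> R) : continuous u ->
  (forall x, 0 < u x) -> forall x, 0 < transition_op P Y u x.
Proof.
move=> cu u0 x; have [x0 [b uab]] := continuous_positive_bounds cu u0.
exact: (transition_op_gt0 Y_markov (continuous_borel cu) (u0 x0) uab).
Qed.

Lemma log_ratio_continuous (u : X -> R) : continuous u ->
  (forall x, 0 < u x) ->
  continuous (fun x => ln (transition_op P Y u x / u x)).
Proof.
move=> cu u0 x; apply: (@continuous_comp _ _ _
    (fun x => transition_op P Y u x / u x) (@ln R)); last first.
  by apply: continuous_ln; rewrite divr_gt0// transition_op_positive.
apply: cvgM; first exact: transition_op_continuous.
by apply: cvgV; [rewrite gt_eqF|exact: cu].
Qed.

Lemma inf_probability_le (C : set (probability (borel X) R))
    (C_closed : closed (C : set (weak_prob X))) n (n_gt0 : (0 < n)%N)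
    (u : X -> R) (c : R) : continuous u -> (forall x, 0 < u x) ->
  (forall nu, C nu -> \int[nu]_x ln (transition_op P Y u x / u x) <= c) ->
  exists x, (P x [set w | C (empirical n_gt0 (Y ^~ w))] <=
    (expR (n%:R * c))%:E)%E.
Proof.
move=> cu u0 Cc; have [x0 [b uab]] := continuous_positive_bounds cu u0.
exists x0; set E := [set w | _].
pose pi := transition_op P Y u.
have pi0 x : 0 < pi x by exact: transition_op_positive.
have [mY Y0 _] := Y_markov.
have mE : measurable E by exact: measurable_empirical_event.
have EZ := expectation_exponential_martingale Y_markov (continuous_borel cu)
  (u0 x0) uab x0 n.
pose Z w := \prod_(k < n) (u (Y k.+1 w) / pi (Y k w)).
(* Shifting the numerators by one index telescopes, and leaves the factor u(Y_n) / u(Y_0), which is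
   at least 1 when the chain starts at the minimum point. *)
have Zu w : Z w * u (Y 0%N w) =
    u (Y n w) * \prod_(k < n) (u (Y k w) / pi (Y k w)).
  rewrite /Z; elim: (n) => [|k ih]; first by rewrite !big_ord0 mul1r mulr1.
  rewrite !big_ord_recr/= mulrAC ih.
  have pik : pi (Y k w) != 0 by rewrite gt_eqF.
  by field.
have prodE w : \prod_(k < n) (u (Y k w) / pi (Y k w)) =
    expR (- (n%:R * \int[empirical n_gt0 (Y ^~ w)]_x ln (pi x / u x))).
  rewrite continuous_Rintegral_empirical//; last exact: log_ratio_continuous.
  rewrite mulVKf ?pnatr_eq0 -?lt0n// -sumrN expR_sum.
  apply: eq_bigr => k _; rewrite expRN lnK ?posrE ?divr_gt0//.
  by rewrite invf_div.
have EZle w : Y 0%N w = x0 -> E w -> expR (- (n%:R * c)) <= Z w.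
  move=> Yw Ew.
  have : expR (- (n%:R * c)) <= \prod_(k < n) (u (Y k w) / pi (Y k w)).
    by rewrite prodE ler_expR lerN2 ler_pM2l ?ltr0n//; exact: Cc.
  have := Zu w; rewrite Yw.
  have /andP[uY _] := uab (Y n w); have ux0 := u0 x0.
  move=> ZE le; rewrite -(ler_pM2r ux0) ZE mulrC.
  by apply: ler_pM => //; exact: ltW.
have mZ : measurable_fun [set: Omega] (fun w => (Z w)%:E).
  apply/measurable_EFinP; apply: (measurable_prod_ratio Y_markov
    (continuous_borel cu) (u0 x0) uab (f := Y)) => k _; exact: mY.
have Z0 w : (0 <= (Z w)%:E)%E.
  by rewrite lee_fin; apply: prodr_ge0 => k _; rewrite divr_ge0// ltW.
(* Markov's inequality: on [E] the variable [Z], of expectation 1, is almost surely at least exp (-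
   n c). *)
have : ((expR (- (n%:R * c)))%:E * P x0 E <= 1)%E.
  rewrite -EZ -integral_cst//.
  apply: (@le_trans _ _ (\int[P x0]_(w in E) (Z w)%:E)%E).
    apply: ae_ge0_le_integral => //.
    - by move=> w _; rewrite lee_fin expR_ge0.
    - exact: measurable_funTS.
    - by apply: filterS (Y0 x0) => w Yw Ew; rewrite lee_fin; exact: EZle.
  exact: ge0_subset_integral.
have PE : P x0 E \is a fin_num by exact: fin_num_measure.
rewrite -(fineK PE) -EFinM !lee_fin expRN.
by rewrite ler_pdivrMl ?expR_gt0// mulr1.
Qed.

End uniform_upper_bound.

(** * Minimax *)

Section affine_alternative.
Context (R : realType).

(* The witness in the contradiction is the intersection of the segment [p, q]
   with the diagonal. *)
Lemma convex_avoiding_quadrant (S : set (R * R)) :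
  (forall (t : R) p q, 0 <= t <= 1 -> S p -> S q ->
    S (t * p.1 + (1 - t) * q.1, t * p.2 + (1 - t) * q.2)) ->
  (forall p, S p -> p.1 <= 0 \/ p.2 <= 0) ->
  exists2 t : R, 0 <= t <= 1 & forall p, S p -> (1 - t) * p.1 + t * p.2 <= 0.
Proof.
move=> Sconv Sneg.
have [S1|] := pselect (forall p, S p -> p.1 <= 0).
  by exists 0 => [|p /S1]; rewrite ?lexx ?ler01// subr0 mul1r mul0r addr0.
move=> /existsNP[p0 /not_implyP[Sp0 /negP]]; rewrite -ltNge => p00.
have cross p q : S p -> S q -> 0 < p.1 -> 0 < q.2 -> p.1 * q.2 <= p.2 * q.1.
  move=> Sp Sq p1 q2; rewrite leNgt; apply/negP => pq.
  have p2 : p.2 <= 0 by have [|//] := Sneg _ Sp; rewrite leNgt p1.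
  have q1 : q.1 <= 0 by have [//|] := Sneg _ Sq; rewrite leNgt q2.
  pose D := (p.1 - p.2) + (q.2 - q.1).
  have D0 : 0 < D by rewrite /D; lra.
  pose t := (q.2 - q.1) / D.
  have t01 : 0 <= t <= 1.
    rewrite /t divr_ge0 ?(ltW D0)//=; last by lra.
    by rewrite ler_pdivrMr// mul1r /D; lra.
  have diag : t * p.1 + (1 - t) * q.1 = (p.1 * q.2 - p.2 * q.1) / D /\
      t * p.2 + (1 - t) * q.2 = (p.1 * q.2 - p.2 * q.1) / D.
    by split; rewrite /t /D; field; rewrite gt_eqF.
  have := Sneg _ (Sconv t p q t01 Sp Sq) => /=.
  rewrite diag.1 diag.2 => -[]; apply/negP; rewrite -ltNge divr_gt0//; lra.
(* For p.1 > 0 >= p.2, this is the least t with (1 - t) p.1 + t p.2 <= 0. The supremum of these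
   lower bounds is the t sought. *)
pose slope (p : R * R) := p.1 / (p.1 - p.2).
have S2 p : S p -> 0 < p.1 -> p.2 <= 0.
  by move=> Sp p1; have [|//] := Sneg _ Sp; rewrite leNgt p1.
pose A := [set slope p | p in [set p | S p /\ 0 < p.1]].
have A1 : ubound A 1.
  move=> _ [p [Sp p1] <-]; have p2 := S2 _ Sp p1.
  by rewrite /slope ler_pdivrMr ?mul1r; lra.
have Asup : has_sup A by split; [exists (slope p0), p0|exists 1].
set t := sup A.
have t1 : t <= 1 by apply: ge_sup => //; case: Asup.
have t0 : 0 <= t.
  apply: (@le_trans _ _ (slope p0)).
    have := S2 _ Sp0 p00; rewrite /slope => ?; rewrite divr_ge0//; lra.
  by apply: sup_upper_bound => //; exists p0.
exists t; first by rewrite t0.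
move=> p Sp.
have [p1|p1] := ltP 0 p.1.
  have p2 := S2 _ Sp p1.
  have : slope p <= t by apply: sup_upper_bound => //; exists p.
  rewrite /slope ler_pdivrMr; last by lra.
  by nra.
have [p2|p2] := ltP 0 p.2; last by nra.
(* A point with p.1 <= 0 < p.2 bounds t from above instead, and [cross] places every slope below
   this bound. *)
have : t <= - p.1 / (p.2 - p.1).
  apply: ge_sup; first by case: Asup.
  move=> _ [q [Sq q1] <-]; have q2 := S2 _ Sq q1.
  rewrite /slope ler_pdivrMr; last by lra.
  rewrite mulrAC ler_pdivlMr; last by lra.
  by have := cross q p Sq Sp q1 p2; lra.
rewrite ler_pdivlMr; last by lra.
by nra.
Qed.

End affine_alternative.

Lemma lt_convex_combination (R : realFieldType) (t a b c : R) : 0 <= t <= 1 ->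
  c < a -> c < b -> c < t * a + (1 - t) * b.
Proof.
move=> /andP[t0 t1] ca cb; have [tpos|tneg] := ltP 0 t.
  have : 0 < t * (a - c) by rewrite mulr_gt0// subr_gt0.
  have : 0 <= (1 - t) * (b - c) by rewrite mulr_ge0 ?subr_ge0// ltW.
  lra.
by rewrite (_ : t = 0) ?mul0r ?subr0 ?mul1r ?add0r//; apply: le_anti; rewrite tneg.
Qed.

Section minimax.
Context (R : realType) (X : pointedMetricType R).
Hypothesis X_compact : compact [set: X].
Context d (Omega : measurableType d).
Variables (K : R.-pker (borel X) ~> (borel X))
  (P : borel X -> probability Omega R) (Y : nat -> Omega -> borel X).
Hypothesis Y_markov : markov_chain K P Y.
Hypothesis Y_feller : forall u : X -> R, continuous u -> bounded_fun u ->
  continuous (transition_op P Y u : X -> R).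
Local Notation pi := (transition_op P Y).

Let U := [set u : X -> R | continuous u /\ forall x, 0 < u x].

Let J (u : X -> R) (nu : probability (borel X) R) : R :=
  \int[nu]_x ln (pi u x / u x).

(** The weighted geometric mean of [u] and [v], that is, the segment between them in the coordinate
    ln u. *)
Let log_mean (t : R) (u v : X -> R) (x : X) : R :=
  expR ((1 - t) * ln (u x) + t * ln (v x)).

Let log_mean_in t u v : U u -> U v -> U (log_mean t u v).
Proof.
move=> [cu u0] [cv v0]; split => [x|x]; last exact: expR_gt0.
apply: (@continuous_comp _ _ _
  (fun x => (1 - t) * ln (u x) + t * ln (v x)) (@expR R)); last exact: continuous_expR.
apply: cvgD; (apply: cvgM; first exact: cvg_cst).
  by apply: (@continuous_comp _ _ _ u (@ln R)); [exact: cu|exact: continuous_ln].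
by apply: (@continuous_comp _ _ _ v (@ln R)); [exact: cv|exact: continuous_ln].
Qed.

Let convex_expR_real (t x y : R) : 0 <= t <= 1 ->
  expR ((1 - t) * x + t * y) <= (1 - t) * expR x + t * expR y.
Proof.
move=> /andP[t0 t1]; set z := _ + _ : R.
(* The tangent at the barycentre [z] lies below the graph; averaging the inequalities at [x] and [y]
   cancels the linear terms. *)
have tangent w : expR z * (1 + (w - z)) <= expR w.
  have <- : expR z * expR (w - z) = expR w by rewrite -expRD addrC subrK.
  by rewrite ler_pM2l ?expR_gt0// expR_ge1Dx.
have := tangent x; have := tangent y; have := expR_gt0 z; rewrite /z.
by nra.
Qed.

Let transition_opE u x : pi u x = \int[P x]_w u (Y 1%N w).
Proof. by rewrite /transition_op unlock. Qed.

Let integrable_next u x : continuous u ->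
  (P x).-integrable [set: Omega] (EFin \o (fun w => u (Y 1%N w))).
Proof.
move=> cu; have [M _ uM] := compact_bound X_compact cu.
apply: (@bounded_integrable _ _ _ _ _ M) => //.
by apply: (measurableT_comp (continuous_borel cu)); case: Y_markov.
Qed.

(** The denominators are affine in ln u, so that what remains is Hölder's inequality for the law of
    [Y 1]. It follows from the convexity of exp after [u] and [v] are divided by their means. *)
Let log_ratio_convex t u v x : 0 <= t <= 1 -> U u -> U v ->
  ln (pi (log_mean t u v) x / log_mean t u v x) <=
  (1 - t) * ln (pi u x / u x) + t * ln (pi v x / v x).
Proof.
move=> t01 Uu Uv; have Uw := log_mean_in t Uu Uv.
have [cu u0] := Uu; have [cv v0] := Uv; have [cw w0] := Uw.
have pu := transition_op_positive X_compact Y_markov cu u0 x.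
have pv := transition_op_positive X_compact Y_markov cv v0 x.
have pw := transition_op_positive X_compact Y_markov cw w0 x.
rewrite !ln_div ?posrE// [X in _ - X]expRK.
suff : ln (pi (log_mean t u v) x) <= (1 - t) * ln (pi u x) + t * ln (pi v x).
  lra.
rewrite -ler_expR lnK ?posrE//; set D := expR _.
have Dgt0 : 0 < D by exact: expR_gt0.
(* [D] is the geometric mean of [pi u x] and [pi v x]. The function [g] dominates the integrand by
   the weighted arithmetic-geometric inequality, and its integral is D (1 - t) + D t = D. *)
pose g w := (D * (1 - t) / pi u x) * u (Y 1%N w) +
  (D * t / pi v x) * v (Y 1%N w).
have ig c (f : X -> R) : continuous f ->
    (P x).-integrable [set: Omega] (EFin \o (fun w => c * f (Y 1%N w))).
  by move=> cf; apply: (integrableZl _ _ (integrable_next x cf)).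
rewrite transition_opE; apply: (@le_trans _ _ (\int[P x]_w g w)).
  apply: le_Rintegral => //.
  - exact: integrable_next.
  - exact: (integrableD measurableT (ig _ _ cu) (ig _ _ cv)).
  move=> w _; rewrite /log_mean /g; set y := Y 1%N w.
  rewrite -[leLHS](divfK (lt0r_neq0 Dgt0)) -expRB [leRHS]addrC.
  rewrite (_ : _ - _ = (1 - t) * (ln (u y) - ln (pi u x)) +
    t * (ln (v y) - ln (pi v x))); last by ring.
  rewrite mulrC; apply: (@le_trans _ _
    (D * ((1 - t) * (u y / pi u x) + t * (v y / pi v x)))).
    rewrite ler_pM2l// (le_trans (convex_expR_real _ _ t01))//.
    by rewrite -!ln_div ?posrE// !lnK// posrE divr_gt0.
  by rewrite le_eqVlt; apply/orP; left; apply/eqP; ring.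
rewrite RintegralD//; [|exact: ig|exact: ig].
rewrite !RintegralZl//; [|exact: integrable_next..].
rewrite -!transition_opE !divfK ?gt_eqF//.
by rewrite -mulrDr subrK mulr1.
Qed.

Let J_convex t u v nu : 0 <= t <= 1 -> U u -> U v ->
  J (log_mean t u v) nu <= (1 - t) * J u nu + t * J v nu.
Proof.
move=> t01 Uu Uv; have Uw := log_mean_in t Uu Uv.
have iJ w : U w -> nu.-integrable [set: borel X]
    (EFin \o (fun x => ln (pi w x / w x))).
  move=> [cw w0]; apply: continuous_integrable => //.
  exact: (log_ratio_continuous X_compact Y_markov Y_feller cw w0).
have iZ c w : U w -> nu.-integrable [set: borel X]
    (EFin \o (fun x => c * ln (pi w x / w x))).
  by move=> Ww; apply: (integrableZl _ _ (iJ w Ww)).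
rewrite /J -!RintegralZl//; [|exact: iJ..].
rewrite -RintegralD//; [|exact: iZ..].
apply: le_Rintegral => //; first exact: iJ.
  exact: (integrableD measurableT (iZ _ _ Uu) (iZ _ _ Uv)).
by move=> x _; exact: log_ratio_convex.
Qed.

Let J_mixture (t : {i01 R}) u mu nu : U u ->
  J u (mixture t mu nu) = t%:num * J u mu + (1 - t%:num) * J u nu.
Proof.
move=> [cu u0]; have cl := log_ratio_continuous X_compact Y_markov Y_feller cu u0.
have [M _ lM] := compact_bound X_compact cl.
exact: (Rintegral_mixture _ _ _ (continuous_borel cl) lM).
Qed.

(** Induction on [s]: the part of [C] where J u > c is convex, and a single v handles it. The pairs
    (J u - c, J v - c) over [C] then form a convex set without a point in the open positive
    quadrant; the weights from [convex_avoiding_quadrant] give a geometric mean of u and v that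
    handles all of [C]. *)
Lemma minimax_finite (s : seq (X -> R)) (c : R)
    (C : set (probability (borel X) R)) :
  convex_prob C -> (forall u, u \in s -> U u) ->
  (forall nu, C nu -> exists2 u, u \in s & J u nu <= c) ->
  exists2 u, U u & forall nu, C nu -> J u nu <= c.
Proof.
elim: s C => [|u s ih] C Cconv sU Cs.
  (* With no candidate left [C] is empty, and any positive function will do. *)
  exists (fun=> 1); first by split => [|x]; [exact: cst_continuous|exact: ltr01].
  by move=> nu /Cs[].
have Uu : U u by apply: sU; rewrite mem_head.
have [|||v Uv vc] := ih (C `&` [set nu | c < J u nu]).
- move=> t mu nu [Cmu cmu] [Cnu cnu]; split; first exact: Cconv.
  rewrite /= J_mixture//.
  have T01 : 0 <= t%:num <= 1 by rewrite ge0 le1.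
  exact: lt_convex_combination.
- by move=> v vs; apply: sU; rewrite inE vs orbT.
- move=> nu [/Cs[v + vc] /= unu]; rewrite inE => /orP[/eqP vu|vs]; last by exists v.
  by move: unu; rewrite -vu ltNge vc.
have [||t t01 tc] := @convex_avoiding_quadrant R
  [set (J u nu - c, J v nu - c) | nu in C].
- move=> t p q /andP[t0 t1] [mu Cmu <-] [nu Cnu <-] /=.
  have t01 : Itv.spec (@Itv.num_sem R) (Itv.Real `[0%Z, 1%Z]) t.
    by rewrite /= /Itv.num_sem/= in_itv/= t0 t1 ger0_real.
  exists (mixture (Itv.mk t01) mu nu); first exact: Cconv.
  rewrite !J_mixture//=; congr pair; ring.
- move=> _ [nu Cnu <-] /=; have [unu|unu] := leP (J u nu) c.
    by left; rewrite subr_le0.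
  by right; rewrite subr_le0; exact: vc.
exists (log_mean t u v); first exact: log_mean_in.
move=> nu Cnu; apply: (le_trans (J_convex nu t01 Uu Uv)).
have := tc _ (ex_intro2 _ _ nu Cnu erefl) => /=; lra.
Qed.

(** Compactness of [C] reduces the claim to [minimax_finite]. If no finite family sufficed, the sets
    [B s] would generate a proper filter on [C]. At a cluster point some J u is below c, strictly
    and hence on a neighbourhood, which is disjoint from [B [:: u]]. *)
Lemma minimax (c : R) (C : set (probability (borel X) R)) :
  closed (C : set (weak_prob X)) -> convex_prob C ->
  (forall nu, C nu -> exists2 u, U u & J u nu < c) ->
  exists2 u, U u & forall nu, C nu -> J u nu <= c.
Proof.
move=> cC Cconv CU.
have [[s [sU sC]]|noS] := pselect (exists s : seq (X -> R),
    (forall u, u \in s -> U u) /\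
    forall nu, C nu -> exists2 u, u \in s & J u nu <= c).
  exact: minimax_finite Cconv sU sC.
exfalso.
have Ccompact : compact (C : set (weak_prob X)).
  by apply: subclosed_compact cC (compact_weak_prob X_compact) _.
pose B (s : seq (X -> R)) : set (weak_prob X) :=
  [set nu | C nu /\ forall u, u \in s -> c < J u nu].
pose I := [set s : seq (X -> R) | forall u, u \in s -> U u].
have PF : ProperFilter (filter_from I B).
  apply: filter_from_proper; first apply: filter_from_filter.
  - by exists [::].
  - move=> s1 s2 I1 I2; exists (s1 ++ s2) => [u|nu [Cnu nus]].
      by rewrite mem_cat => /orP[/I1|/I2].
    by split; split => // u us; apply: nus; rewrite mem_cat us ?orbT.
  move=> s Is; apply: contrapT => /set0P/negP/negPn/eqP Bs0; apply: noS.
  exists s; split => // nu Cnu; apply: contrapT => nos.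
  suff : B s nu by rewrite Bs0.
  split => // u us; rewrite ltNge; apply/negP => unu; apply: nos.
  by exists u.
have FC : filter_from I B C by exists [::] => // nu [].
have [nu [Cnu clnu]] := Ccompact _ PF FC.
have [u Uu unu] := CU _ Cnu.
have [cu u0] := Uu.
have cl := log_ratio_continuous X_compact Y_markov Y_feller cu u0.
have uB : filter_from I B (B [:: u]).
  by exists [:: u] => // v; rewrite inE => /eqP ->.
have nbu : nbhs nu [set mu : weak_prob X | J u mu < c].
  have /continuousP oJ := continuous_integral X_compact cl.
  apply: open_nbhs_nbhs; split => //.
  have oc : open [set y : R | y < c] by exact: open_lt.
  exact: oJ oc.
have [mu [[_ /(_ u)]]] := clnu _ _ uB nbu.
by rewrite mem_head => /(_ isT) /ltW; rewrite leNgt => /negP.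
Qed.

End minimax.

(** * Passage to the extended real exponent *)

Lemma ereal_dense_EFin (R : realType) (x : R) (y : \bar R) : (x%:E < y)%E ->
  exists2 z : R, x < z & (z%:E < y)%E.
Proof.
case: y => [y|_|//]; last by exists (x + 1); rewrite ?ltrDl// ltry.
by rewrite lte_fin => xy; exists ((x + y) / 2); rewrite ?lte_fin; lra.
Qed.

Theorem mainTheorem2 (R : realType) (X : pointedMetricType R)
    (X_compact : compact [set: X])
    (d : measure_display) (Omega : measurableType d)
    (K : R.-pker (borel X) ~> (borel X))
    (P : borel X -> probability Omega R) (Y : nat -> Omega -> borel X)
    (Y_markov : markov_chain K P Y)
    (Y_feller : forall u : X -> R, continuous u -> bounded_fun u ->
       continuous (transition_op P Y u : X -> R))
    (C : set (probability (borel X) R))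
    (C_closed : closed (C : set (weak_prob X)))
    (C_convex : convex_prob C)
    (n : nat) (n_gt0 : (0 < n)%N) :
  (ereal_inf [set P x [set w | C (empirical n_gt0 (Y ^~ w))] | x in [set: X]]
   <= expeR (- (n%:R%:E * ereal_inf [set rate (transition_op P Y) mu | mu in C])))%E.
Proof.
set p := ereal_inf _; set I := ereal_inf _.
have n0 : 0 < n%:R :> R by rewrite ltr0n.
(* The infimum [I] may be infinite and need not be attained. A real [l] strictly below it supplies
   the strict inequality required by [minimax], used with c = - l. *)
have bound (l : R) : (l%:E < I)%E -> (p <= (expR (- (n%:R * l)))%:E)%E.
  move=> lI.
  have [nu Cnu|u [cu u0] Cu] := minimax X_compact Y_markov Y_feller
      (c := - l) C_closed C_convex.
    have : (l%:E < rate (transition_op P Y) nu)%E.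
      by apply: (lt_le_trans lI); apply: ereal_inf_lbound; exists nu.
    rewrite /rate lteNr => /ereal_inf_lt[_ [u [cu u0] <-]] ul.
    exists u => //; rewrite -lte_fin fineK//.
    apply: integrable_fin_num => //; apply: continuous_integrable => //.
    exact: (log_ratio_continuous X_compact Y_markov Y_feller cu u0).
  have [x Px] := inf_probability_le X_compact Y_markov Y_feller C_closed
    n_gt0 cu u0 Cu.
  rewrite -mulrN; apply: le_trans Px; apply: ereal_inf_lbound.
  by exists x.
have p0 : (0 <= p)%E by apply: le_ereal_inf_tmp => _ [x _ <-].
have p1 : (p <= 1)%E.
  apply: (@le_trans _ _ (P point [set w | C (empirical n_gt0 (Y ^~ w))])).
    by apply: ereal_inf_lbound; exists point.
  apply: probability_le1; apply: measurable_empirical_event => //.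
  by case: Y_markov.
have pfin : p \is a fin_num by rewrite ge0_fin_numE// (le_lt_trans p1)// ltry.
rewrite -(fineK pfin) in p0 bound *; move: (fine p) p0 bound => q.
rewrite lee_fin le_eqVlt => /predU1P[<-|q0] bound; first exact: expeR_ge0.
have -> : q%:E = expeR (ln q)%:E by rewrite /= lnK.
rewrite ler_expeR leeNr -EFinN -lee_pdivlMl//.
(* Otherwise some real [l] lies strictly between - ln q / n and [I], and [bound] gives q <= exp (- n
   l) < q. *)
rewrite leNgt; apply/negP => /ereal_dense_EFin[l ql] /bound.
rewrite lee_fin leNgt => /negP; apply.
rewrite -[ltRHS]lnK ?posrE// ltr_expR ltrNl.
by rewrite -ltr_pdivrMl.
Qed.
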